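(* Let $n\in\mathbb{N}$, let $B=\{0,1\}^n$ be a finite Boolean lattice, let $L$ be a complete lattice and let $\mu:B\to L$ be an $L$-valued up-set. For $x\in B$ put $\overline{x}=\bigcap\{\mu_p\mid p\in L,\ x\in\mu_p\}$. Then there exist a complete lattice $L_1$ and a lattice valued function $\nu:B\to L_1$ defined by the formula $$\nu(x)=\bigvee_{i=1}^n (w_i\cdot x_i),\qquad x=(x_1,\ldots,x_n)\in B,$$ for some $w_1,\ldots,w_n\in L_1$, such that the collections of cuts of $\mu$ and $\nu$ coincide (i.e., $\{\mu_p\mid p\in L\}=\{\nu_q\mid q\in L_1\}$), if and only if $\overline{x\vee y}=\overline{x}\cap\overline{y}$ for all $x,y\in B$.
   Context: $B=\{0,1\}^n$ is ordered componentwise with respect to $0\le 1$. For a complete lattice $L$, an $L$-valued up-set on $B$ is a function $\mu:B\to L$ such that $x\le y$ implies $\mu(x)\le\mu(y)$. For $p\in L$, the cut of $\mu:B\to L$ is $\mu_p=\{x\in B\mid\mu(x)\ge p\}$ (and similarly for $\nu:B\to L_1$). For an element $w$ of a complete lattice and $x\in\{0,1\}$, $w\cdot x$ is defined by $w\cdot 1=w$ and $w\cdot 0=0$ (the bottom of the lattice). *)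

(* Defs.v *)
From mathcomp Require Import all_boot all_order.
From mathcomp Require Import boolp classical_sets.

Set Implicit Arguments.
Unset Strict Implicit.
Unset Printing Implicit Defensive.

Import Order.Theory.

Local Open Scope order_scope.
Local Open Scope classical_set_scope.

(* Makes the componentwise order the canonical one on [n.-tuple bool]. *)
Import Order.DefaultTupleProdOrder.

Notation cube n := (n.-tuple bool).

Definition complete_lattice (d : Order.disp_t) (L : tbLatticeType d) : Prop :=
  forall A : set L, supremums A !=set0 /\ infimums A !=set0.

Section Cuts.
Context (n : nat) (d : Order.disp_t) (L : tbLatticeType d).
Implicit Types (mu : cube n -> L) (p w : L) (x : cube n).

Definition valued_upset mu : Prop := {homo mu : x y / x <= y}.

Definition cut mu p : set (cube n) := [set x | p <= mu x].

Definition cuts mu : set (set (cube n)) := range (cut mu).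

Definition cut_closure mu x : set (cube n) :=
  \bigcap_(p in [set p | cut mu p x]) cut mu p.

Definition scale w (b : bool) : L := if b then w else \bot.

End Cuts.

(* Main.v *)
Require Import Defs.
From HB Require Import structures.
From mathcomp Require Import all_boot all_order.
From mathcomp Require Import boolp classical_sets.

(** The closure of [x] is the single cut [cut mu (mu x)], and it is also the
    intersection of all members of [cuts mu] containing [x], so it depends only
    on the collection of cuts.

    A function of the form [\join_i scale (w i) (tnth x i)] turns joins of the
    cube into joins of its codomain, and a cut at a join is the intersection of
    the two cuts.  Hence for such a [nu] the closure of [x `|` y] is the
    intersection of those of [x] and [y], and the same holds for any [mu] with
    the same cuts.

    Conversely, [mu] itself need not preserve joins: [mu (x `|` y)] may lie
    strictly above [mu x `|` mu y].  The remedy is to discard the elements of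
    [L] that the cuts cannot see.  The map [hull mu] sends [p] to the meet of
    all the values of [mu] above [p]; it is a closure operator which does not
    change the cut at [p] and fixes every value of [mu].  Its fixed points form
    a complete lattice [L1] under the order of [L], in which the join is the
    hull of the join in [L] (lemma [closed_joinP]), and [nu] is [mu] seen as a
    map into [L1]; it has the same cuts as [mu].  The hull of an element depends
    only on its cut ([hull_eq]), so the identity on closures says exactly that
    [mu x `|` mu y] and [mu (x `|` y)] have the same hull, that is, that [nu]
    preserves binary joins.  Monotonicity of [mu] makes [nu \bot] the bottom
    of [L1].  A map preserving finite joins is determined by its values [w i]
    on the unit vectors of the cube ([join_morphism_unit_vectors]). *)

Set Implicit Arguments.
Unset Strict Implicit.
Unset Printing Implicit Defensive.

Import Order.Theory Order.DefaultTupleProdOrder.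

Local Open Scope order_scope.
Local Open Scope classical_set_scope.

(** [closure_le] condenses monotonicity and idempotence into one axiom: given
    [le_closure], it says that [p] and its closure have the same closed upper
    bounds. *)
Record closure_operator (d : Order.disp_t) (L : porderType d) := ClosureOperator {
  closure_fun :> L -> L;
  le_closure : forall p, p <= closure_fun p;
  closure_le : forall p q, p <= closure_fun q -> closure_fun p <= closure_fun q
}.

Section ClosedElements.
Context (d : Order.disp_t) (L : tbLatticeType d) (c : closure_operator L).

(** A record, rather than a sigma type, so that it can carry a lattice structure
    of its own. *)
Record closed_elt := ClosedElt { closed_val : L; _ : c closed_val == closed_val }.

HB.instance Definition _ := [isSub for closed_val].
HB.instance Definition _ := [Choice of closed_elt by <:].
HB.instance Definition _ := [SubChoice_isSubPOrder of closed_elt by <: with d].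

Lemma closureK p : c (c p) == c p.
Proof. by rewrite eq_le closure_le ?le_closure. Qed.

Lemma le_closed p q : p <= q -> c q = q -> c p <= q.
Proof. by move=> le_pq cq; rewrite -cq closure_le ?cq. Qed.

Definition to_closed p : closed_elt := ClosedElt (closureK p).

Lemma val_closed (u : closed_elt) : c (val u) = val u.
Proof. exact: eqP (valP u). Qed.

(** The closure is left adjoint to the inclusion of closed elements; this is why
    suprema of closed elements are closures of suprema. *)
Lemma to_closedP p (u : closed_elt) : (to_closed p <= u) = (p <= val u).
Proof.
rewrite leEsub SubK; apply/idP/idP => [|le_pu]; first exact/le_trans/le_closure.
exact: le_closed (val_closed u).
Qed.

Lemma closed_meet_subproof (u v : closed_elt) :
  c (val u `&` val v)%O == (val u `&` val v)%O.
Proof.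
by rewrite eq_le le_closure andbT lexI !le_closed ?val_closed ?leIl ?leIr.
Qed.

Definition closed_meet u v : closed_elt := ClosedElt (closed_meet_subproof u v).
Definition closed_join (u v : closed_elt) := to_closed (val u `|` val v)%O.

Lemma closed_meetP (t u v : closed_elt) :
  (t <= closed_meet u v) = (t <= u) && (t <= v).
Proof. by rewrite !leEsub SubK lexI. Qed.

Lemma closed_joinP (u v t : closed_elt) :
  (closed_join u v <= t) = (u <= t) && (v <= t).
Proof. by rewrite to_closedP leUx !leEsub. Qed.

HB.instance Definition _ :=
  @Order.POrder_MeetJoin_isLattice.Build d closed_elt closed_meet closed_join
    closed_meetP closed_joinP.

Lemma closed_le0x (u : closed_elt) : to_closed \bot <= u.
Proof. by rewrite to_closedP le0x. Qed.

Lemma closed_lex1 (u : closed_elt) : u <= to_closed \top.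
Proof. by rewrite leEsub SubK (le_trans (lex1 _)) ?le_closure. Qed.

HB.instance Definition _ :=
  @Order.hasBottom.Build d closed_elt (to_closed \bot) closed_le0x.
HB.instance Definition _ :=
  @Order.hasTop.Build d closed_elt (to_closed \top) closed_lex1.

(** Infima of closed elements are computed in [L], being closed already, while
    suprema have to be closed afterwards. *)
Lemma closed_elt_complete :
  complete_lattice L -> complete_lattice (closed_elt : tbLatticeType d).
Proof.
move=> hL A; have [[s [ubs lbs]] [i [lbi ubi]]] := hL (val @` A); split.
  exists (to_closed s); split=> u.
    move=> Au; rewrite leEsub SubK (le_trans _ (le_closure c s))// ubs//.
    by exists u.
  move=> ubu; rewrite to_closedP lbs// => _ [v Av <-].
  by rewrite -leEsub ubu.
(* [c i] is still a lower bound of [A], since the elements of [A] are closed. *)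
have ci : c i == i.
  rewrite eq_le le_closure andbT ubi// => _ [u Au <-].
  by rewrite le_closed ?val_closed// lbi//; exists u.
exists (ClosedElt ci); split=> u.
  by move=> Au; rewrite leEsub SubK lbi//; exists u.
move=> lbu; rewrite leEsub SubK ubi// => _ [v Av <-].
by rewrite -leEsub lbu.
Qed.

End ClosedElements.

Section Hull.
Context (d : Order.disp_t) (L : tbLatticeType d) (T : finType) (f : T -> L).

Definition hull p := \meet_(x | p <= f x) f x.

Lemma le_hull p : p <= hull p.
Proof. exact/meetsP. Qed.

(** [p] and its hull lie below the same values of [f]: this yields both the
    idempotence of the hull and its invisibility to the cuts of [f]. *)
Lemma hull_le_image p x : (hull p <= f x) = (p <= f x).
Proof.
apply/idP/idP => [|le_px]; first exact/le_trans/le_hull.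
exact: meets_inf.
Qed.

Lemma hull_le p q : p <= hull q -> hull p <= hull q.
Proof.
move=> le_pq; apply/meetsP => x le_qx.
by rewrite hull_le_image (le_trans le_pq) ?hull_le_image.
Qed.

Definition hull_closure := ClosureOperator le_hull hull_le.

Lemma hull_image x : hull (f x) == f x.
Proof. by rewrite eq_le le_hull hull_le_image lexx. Qed.

End Hull.

Section Cube.
Context (n : nat).
Implicit Types x y : cube n.

Definition unit_vector (i : 'I_n) : cube n := [tuple i == j | j < n].

Lemma joins_unit_vector x :
  x = \join_(i < n) (if tnth x i then unit_vector i else \bot).
Proof.
apply/le_anti/andP; split; last first.
  apply/joinsP => i _; case: ifP => // xi; rewrite ?le0x// leEtprod.
  by apply/forallP => j; rewrite tnth_mktuple; case: eqP => // <-; rewrite xi.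
rewrite leEtprod; apply/forallP => i; case xi: (tnth x i) => //.
suff: unit_vector i <= \join_(i < n) (if tnth x i then unit_vector i else \bot).
  by rewrite leEtprod => /forallP/(_ i); rewrite tnth_mktuple eqxx.
by apply: (joins_min (j := i)); rewrite ?xi.
Qed.

(** Every vector is the join of the unit vectors at its nonzero coordinates;
    preservation of [\bot] covers the empty join and the zero coordinates. *)
Lemma join_morphism_unit_vectors d (L : tbLatticeType d) (nu : cube n -> L) x :
  {morph nu : y z / (y `|` z)%O} -> nu \bot = \bot ->
  nu x = \join_(i < n) scale (nu (unit_vector i)) (tnth x i).
Proof.
move=> nuU nu0; rewrite {1}[x]joins_unit_vector (big_morph nu nuU nu0).
by apply: eq_bigr => i _; rewrite /scale; case: (tnth x i).
Qed.

Lemma joins_scaleU d (L : tbLatticeType d) (w : 'I_n -> L) x y :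
  \join_(i < n) scale (w i) (tnth (x `|` y)%O i) =
  (\join_(i < n) scale (w i) (tnth x i)
     `|` \join_(i < n) scale (w i) (tnth y i))%O.
Proof.
rewrite -big_split; apply: eq_bigr => i _ /=.
by rewrite tnth_join /scale; case: (tnth x i) (tnth y i) => [] [];
  rewrite ?joinxx ?join0x ?joinx0.
Qed.

Context (d : Order.disp_t) (L : tbLatticeType d).
Implicit Types mu : cube n -> L.

(** Cuts shrink as the threshold grows, and [mu x] is the largest threshold [p]
    with [x] in [cut mu p]. *)
Lemma cut_closureE mu x : cut_closure mu x = cut mu (mu x).
Proof.
apply/seteqP; split => y; first by apply; rewrite /cut /= lexx.
by move=> le_xy p px; apply: le_trans px le_xy.
Qed.

(** The closure depends on [mu] only through its collection of cuts, which lets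
    it be transferred between functions with different codomains. *)
Lemma cut_closure_cuts mu x :
  cut_closure mu x = \bigcap_(C in [set C | cuts mu C /\ C x]) C.
Proof.
apply/seteqP; split => y yx.
  by move=> _ [[p _ <-] px]; apply: yx.
by move=> p px; apply: yx; split=> //; exists p.
Qed.

Lemma cutU mu p q : cut mu (p `|` q)%O = cut mu p `&` cut mu q.
Proof. by apply/seteqP; split => x; rewrite /cut /= leUx => /andP. Qed.

Lemma cut_hull mu p : cut mu (hull mu p) = cut mu p.
Proof. by apply/seteqP; split => x; rewrite /cut /= hull_le_image. Qed.

Lemma hull_eq mu p q : cut mu p = cut mu q -> hull mu p = hull mu q.
Proof.
move=> /seteqP[pq qp]; rewrite /hull; apply: eq_bigl => x.
by apply/idP/idP; [apply: pq | apply: qp].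
Qed.

End Cube.

Theorem corollary5p7 (n : nat) (d : Order.disp_t) (L : tbLatticeType d)
    (mu : cube n -> L) (hL : complete_lattice L) (hmu : valued_upset mu) :
  (exists (d1 : Order.disp_t) (L1 : tbLatticeType d1) (nu : cube n -> L1)
          (w : 'I_n -> L1),
      [/\ complete_lattice L1,
          forall x : cube n, nu x = \join_(i < n) scale (w i) (tnth x i)
        & cuts mu = cuts nu])
  <->
  (forall x y : cube n,
      cut_closure mu (x `|` y)%O = cut_closure mu x `&` cut_closure mu y).
Proof.
split=> [[d1 [L1 [nu [w [_ nuE cuts_eq]]]]] x y|muU].
  rewrite !cut_closure_cuts cuts_eq -!cut_closure_cuts !cut_closureE.
  by rewrite !nuE joins_scaleU cutU.
pose c := hull_closure mu.
pose nu x : closed_elt c := ClosedElt (hull_image mu x : c (mu x) == mu x).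
have nuU : {morph nu : x y / (x `|` y)%O}.
  (* The join in [closed_elt c] is the hull of the join in [L], and
     [mu (x `|` y)] is its own hull, so it suffices to compare cuts. *)
  move=> x y; apply: val_inj; rewrite SubK; apply/esym.
  rewrite -[RHS](eqP (hull_image mu _)); apply: hull_eq.
  by rewrite cutU -!cut_closureE muU.
have nu0 : nu \bot = \bot.
  by apply/eqP; rewrite -lex0 leEsub SubK; apply/meetsP => x _; rewrite hmu ?le0x.
have cut_nu u : cut nu u = cut mu (val u).
  by apply/seteqP; split => x; rewrite /cut /= leEsub.
exists d, (closed_elt c : tbLatticeType d), nu, (nu \o @unit_vector n); split.
- exact: closed_elt_complete.
- by move=> x; apply: join_morphism_unit_vectors.
apply/seteqP; split => _ [p _ <-]; last by exists (val p); rewrite ?cut_nu.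
by exists (to_closed c p); rewrite // cut_nu SubK cut_hull.
Qed.
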